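(* Let $\lambda\in K$, let $(A,R,\alpha_{A},\beta_{A})$ be a Rota-Baxter BiHom-associative algebra of weight $\lambda$ with $\alpha_A,\beta_A$ bijective, and let $(M,R,T,\alpha_{M},\beta_{M},\alpha_{A},\beta_{A})$ be a Rota-Baxter paired (left) $(A,\mu,\alpha_{A},\beta_{A})$-module of weight $\lambda$, with action $\triangleright$. Define a map $\triangleright_{\star}:A\otimes M\to M$ by $$a\triangleright_{\star}m=R(a)\triangleright m+a\triangleright T(m)+\lambda\,a\triangleright m$$ for all $a\in A$, $m\in M$. Then $(M,\triangleright_{\star},\alpha_{M},\beta_{M})$ is a left $(A,\star,\alpha_{A},\beta_{A})$-pre-Lie module, where $$a\star b=R(a)b+\lambda ab-\alpha_A^{-1}\beta_A(b)\,R(\alpha_A\beta_A^{-1}(a)).$$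
   Context: $K$ is a field; everything is $K$-linear. A BiHom-associative algebra $(A,\mu,\alpha_A,\beta_A)$ is a vector space $A$ with linear maps $\mu:A\otimes A\to A$, $\mu(a\otimes b)=ab$, and commuting $\alpha_A,\beta_A:A\to A$, multiplicative for $\mu$, with $\alpha_A(a)(bc)=(ab)\beta_A(c)$. A Rota-Baxter BiHom-associative algebra $(A,R,\alpha_A,\beta_A)$ of weight $\lambda$ is a BiHom-associative algebra with a linear map $R:A\to A$ commuting with $\alpha_A,\beta_A$ and satisfying $R(a)R(b)=R(R(a)b)+R(aR(b))+\lambda R(ab)$. A left $(A,\mu,\alpha_A,\beta_A)$-module $(M,\triangleright,\alpha_M,\beta_M)$: a vector space $M$ with commuting linear maps $\alpha_M,\beta_M:M\to M$ and linear $\triangleright:A\otimes M\to M$ with $\alpha_M(a\triangleright m)=\alpha_A(a)\triangleright\alpha_M(m)$, $\beta_M(a\triangleright m)=\beta_A(a)\triangleright\beta_M(m)$, $\alpha_A(a)\triangleright(b\triangleright m)=(ab)\triangleright\beta_M(m)$. A Rota-Baxter paired (left) $(A,\mu,\alpha_A,\beta_A)$-module of weight $\lambda$, $(M,R,T,\alpha_M,\beta_M,\alpha_A,\beta_A)$: a left $(A,\mu,\alpha_A,\beta_A)$-module $(M,\triangleright,\alpha_M,\beta_M)$ (that is, a vector space $M$ with commuting linear maps $\alpha_M,\beta_M:M\to M$ and linear $\triangleright:A\otimes M\to M$ with $\alpha_M(a\triangleright m)=\alpha_A(a)\triangleright\alpha_M(m)$, $\beta_M(a\triangleright m)=\beta_A(a)\triangleright\beta_M(m)$,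 $\alpha_A(a)\triangleright(b\triangleright m)=(ab)\triangleright\beta_M(m)$ for all $a,b\in A$, $m\in M$) with linear maps $R:A\to A$, $T:M\to M$ such that $T$ commutes with $\alpha_M,\beta_M$, $R$ commutes with $\alpha_A,\beta_A$, and $R(a)\triangleright T(m)=T(R(a)\triangleright m)+T(a\triangleright T(m))+\lambda T(a\triangleright m)$. A (left) BiHom-pre-Lie algebra $(A,\cdot,\alpha_A,\beta_A)$: a vector space with a bilinear operation $\cdot$ and commuting linear maps $\alpha_A,\beta_A$ multiplicative for $\cdot$ with $\alpha_A\beta_A(a)\cdot(\alpha_A(b)\cdot c)-(\beta_A(a)\cdot\alpha_A(b))\cdot\beta_A(c)=\alpha_A\beta_A(b)\cdot(\alpha_A(a)\cdot c)-(\beta_A(b)\cdot\alpha_A(a))\cdot\beta_A(c)$. A left pre-Lie module over a BiHom-pre-Lie algebra $(A,\cdot,\alpha_A,\beta_A)$ is $(M,\triangleright,\alpha_M,\beta_M)$ with $\alpha_M\beta_M=\beta_M\alpha_M$, $\alpha_M(a\triangleright m)=\alpha_A(a)\triangleright\alpha_M(m)$, $\beta_M(a\triangleright m)=\beta_A(a)\triangleright\beta_M(m)$ and $\alpha_A\beta_A(a)\triangleright(\alpha_A(b)\triangleright m)-(\beta_A(a)\cdot\alpha_A(b))\triangleright\beta_M(m)=\alpha_A\beta_A(b)\triangleright(\alpha_A(a)\triangleright m)-(\beta_A(b)\cdot\alpha_A(a))\triangleright\beta_M(m)$ for all $a,b\in A$, $m\in M$. *)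

(* Defs.v *)
From HB Require Import structures.
From mathcomp Require Import all_boot all_order all_algebra.

Set Implicit Arguments.
Unset Strict Implicit.
Unset Printing Implicit Defensive.

Import GRing.Theory.
Local Open Scope ring_scope.

(* A linear map U (x) V -> W is encoded as a curried bilinear map
   U -> V -> W.  MathComp's [bilinear_for] says the same, but lives in Type. *)
Definition is_bilinear (K : fieldType) (U V W : lmodType K)
    (f : U -> V -> W) : Prop :=
  (forall v, linear (f^~ v)) /\ (forall u, linear (f u)).

(* The inverse of a bijective map between choice types. *)
Lemma bij_preim (S T : choiceType) (f : S -> T) (bf : bijective f) (y : T) :
  exists x, f x == y.
Proof. by case: bf => g _ gK; exists (g y); rewrite gK. Qed.

Definition bij_inv (S T : choiceType) (f : S -> T) (bf : bijective f)
    (y : T) : S := xchoose (bij_preim bf y).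

Lemma bij_invKV (S T : choiceType) (f : S -> T) (bf : bijective f) :
  cancel (bij_inv bf) f.
Proof. by move=> y; apply/eqP; apply: (xchooseP (bij_preim bf y)). Qed.

Lemma bij_invK (S T : choiceType) (f : S -> T) (bf : bijective f) :
  cancel f (bij_inv bf).
Proof. by move=> x; apply: (bij_inj bf); rewrite bij_invKV. Qed.

Record bihom_associative (K : fieldType) (A : lmodType K)
    (mu : A -> A -> A) (alphaA betaA : A -> A) : Prop := BiHomAssociative {
  bha_mu_bilinear : is_bilinear mu;
  bha_alpha_linear : linear alphaA;
  bha_beta_linear : linear betaA;
  bha_comm : forall a, alphaA (betaA a) = betaA (alphaA a);
  bha_alpha_mu : forall a b, alphaA (mu a b) = mu (alphaA a) (alphaA b);
  bha_beta_mu : forall a b, betaA (mu a b) = mu (betaA a) (betaA b);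
  bha_assoc : forall a b c, mu (alphaA a) (mu b c) = mu (mu a b) (betaA c)
}.

Record rota_baxter_bihom_associative (K : fieldType) (A : lmodType K)
    (lambda : K) (mu : A -> A -> A) (R alphaA betaA : A -> A) : Prop :=
  RotaBaxterBiHomAssociative {
  rba_bha : bihom_associative mu alphaA betaA;
  rba_R_linear : linear R;
  rba_R_alpha : forall a, R (alphaA a) = alphaA (R a);
  rba_R_beta : forall a, R (betaA a) = betaA (R a);
  rba_rota_baxter : forall a b,
    mu (R a) (R b) = R (mu (R a) b) + R (mu a (R b)) + lambda *: R (mu a b)
}.

Record bihom_module (K : fieldType) (A M : lmodType K)
    (mu : A -> A -> A) (alphaA betaA : A -> A)
    (act : A -> M -> M) (alphaM betaM : M -> M) : Prop := BiHomModule {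
  bhm_act_bilinear : is_bilinear act;
  bhm_alpha_linear : linear alphaM;
  bhm_beta_linear : linear betaM;
  bhm_comm : forall m, alphaM (betaM m) = betaM (alphaM m);
  bhm_alpha_act : forall a m, alphaM (act a m) = act (alphaA a) (alphaM m);
  bhm_beta_act : forall a m, betaM (act a m) = act (betaA a) (betaM m);
  bhm_assoc : forall a b m,
    act (alphaA a) (act b m) = act (mu a b) (betaM m)
}.

(* R is not required to be a Rota-Baxter operator on A here. *)
Record rota_baxter_paired_module (K : fieldType) (A M : lmodType K)
    (lambda : K) (mu : A -> A -> A) (act : A -> M -> M)
    (R : A -> A) (T alphaM betaM : M -> M) (alphaA betaA : A -> A) : Prop :=
  RotaBaxterPairedModule {
  rbm_bhm : bihom_module mu alphaA betaA act alphaM betaM;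
  rbm_R_linear : linear R;
  rbm_T_linear : linear T;
  rbm_T_alpha : forall m, T (alphaM m) = alphaM (T m);
  rbm_T_beta : forall m, T (betaM m) = betaM (T m);
  rbm_R_alpha : forall a, R (alphaA a) = alphaA (R a);
  rbm_R_beta : forall a, R (betaA a) = betaA (R a);
  rbm_rota_baxter : forall a m,
    act (R a) (T m)
    = T (act (R a) m) + T (act a (T m)) + lambda *: T (act a m)
}.

Record bihom_preLie (K : fieldType) (A : lmodType K)
    (op : A -> A -> A) (alphaA betaA : A -> A) : Prop := BiHomPreLie {
  bpl_op_bilinear : is_bilinear op;
  bpl_alpha_linear : linear alphaA;
  bpl_beta_linear : linear betaA;
  bpl_comm : forall a, alphaA (betaA a) = betaA (alphaA a);
  bpl_alpha_op : forall a b, alphaA (op a b) = op (alphaA a) (alphaA b);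
  bpl_beta_op : forall a b, betaA (op a b) = op (betaA a) (betaA b);
  bpl_preLie : forall a b c,
    op (alphaA (betaA a)) (op (alphaA b) c)
      - op (op (betaA a) (alphaA b)) (betaA c)
    = op (alphaA (betaA b)) (op (alphaA a) c)
      - op (op (betaA b) (alphaA a)) (betaA c)
}.

Record preLie_module (K : fieldType) (A M : lmodType K)
    (op : A -> A -> A) (alphaA betaA : A -> A)
    (act : A -> M -> M) (alphaM betaM : M -> M) : Prop := PreLieModule {
  plm_act_bilinear : is_bilinear act;
  plm_alpha_linear : linear alphaM;
  plm_beta_linear : linear betaM;
  plm_comm : forall m, alphaM (betaM m) = betaM (alphaM m);
  plm_alpha_act : forall a m, alphaM (act a m) = act (alphaA a) (alphaM m);
  plm_beta_act : forall a m, betaM (act a m) = act (betaA a) (betaM m);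
  plm_preLie : forall a b m,
    act (alphaA (betaA a)) (act (alphaA b) m)
      - act (op (betaA a) (alphaA b)) (betaM m)
    = act (alphaA (betaA b)) (act (alphaA a) m)
      - act (op (betaA b) (alphaA a)) (betaM m)
}.

Definition star_act (K : fieldType) (A M : lmodType K) (lambda : K)
    (act : A -> M -> M) (R : A -> A) (T : M -> M) (a : A) (m : M) : M :=
  act (R a) m + act a (T m) + lambda *: act a m.

Definition star_mul (K : fieldType) (A : lmodType K) (lambda : K)
    (mu : A -> A -> A) (R alphaA betaA : A -> A)
    (bij_alphaA : bijective alphaA) (bij_betaA : bijective betaA)
    (a b : A) : A :=
  mu (R a) b + lambda *: mu a b
  - mu (bij_inv bij_alphaA (betaA b)) (R (alphaA (bij_inv bij_betaA a))).

(* Main.v *)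
Require Import Defs.
From mathcomp Require Import all_boot all_order all_algebra.

Import GRing.Theory.
Local Open Scope ring_scope.

(** The operation [star_mul] is the commutator-like product attached to a
    BiHom-dendriform structure.  Put
      a prec b = a R(b)   and   a succ b = R(a) b + lambda a b.
    The Rota-Baxter identity says exactly that R is multiplicative from the
    total product a * b = a prec b + a succ b to the original product, and this
    makes (prec, succ) BiHom-dendriform ([rb_dendriform]).

    The inverse maps in [star_mul] disappear on arguments of the form beta a,
    alpha b, where
      star (beta a) (alpha b)
        = (beta a) succ (alpha b) - (beta b) prec (alpha a).
    As alpha and beta are onto, this equation characterises [star_mul]; the rest
    of the argument uses nothing else about it.  The pre-Lie identity
    ([dendriform_preLie]) is then a direct expansion: the three dendriform
    axioms turn the associator into an expression symmetric in a and b.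

    For the module, [star_act] is an honest module over the total product
    ([star_act_bihom_module]): R(a * b) acts as R(a) R(b), and the paired
    Rota-Baxter identity evaluates T on b star_act m.  Finally star and the
    total product have the same BiHom-commutator, and the pre-Lie module axiom
    only involves that commutator ([bihom_module_preLie]). *)

(** * Linear and bilinear maps *)

Section Linearity.
Context {K : fieldType} {U V : lmodType K}.

Lemma linear_add {f : U -> V} : linear f -> forall u v, f (u + v) = f u + f v.
Proof. by move=> lf u v; have := lf 1 u v; rewrite !scale1r. Qed.

Lemma linear_zero {f : U -> V} : linear f -> f 0 = 0.
Proof. by move=> lf; apply: (addrI (f 0)); rewrite -linear_add // !addr0. Qed.

Lemma linear_scale {f : U -> V} :
  linear f -> forall k u, f (k *: u) = k *: f u.
Proof.
by move=> lf k u; have := lf k u 0; rewrite !addr0 (linear_zero lf) addr0.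
Qed.

Lemma linear_sub {f : U -> V} : linear f -> forall u v, f (u - v) = f u - f v.
Proof.
by move=> lf u v; rewrite -scaleN1r linear_add // linear_scale // scaleN1r.
Qed.

Lemma linear_const0 : linear (fun _ : U => 0 : V).
Proof. by move=> k u v; rewrite scaler0 addr0. Qed.

Lemma linearP_add (f g : U -> V) :
  linear f -> linear g -> linear (fun u => f u + g u).
Proof. by move=> lf lg k u v; rewrite lf lg scalerDr addrACA. Qed.

Lemma linearP_sub (f g : U -> V) :
  linear f -> linear g -> linear (fun u => f u - g u).
Proof. by move=> lf lg k u v; rewrite lf lg scalerBr opprD addrACA. Qed.

Lemma linearP_scale (c : K) (f : U -> V) :
  linear f -> linear (fun u => c *: f u).
Proof.
by move=> lf k u v; rewrite lf scalerDr !scalerA [c * k]mulrC.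
Qed.

End Linearity.

Section Bilinearity.
Context {K : fieldType} {U V W : lmodType K}.

Lemma linearP_comp (f : U -> V) (g : V -> W) :
  linear f -> linear g -> linear (fun u => g (f u)).
Proof. by move=> lf lg k u v; rewrite lf lg. Qed.

Lemma linear_surj {f : U -> V} {g : V -> W} :
  bijective f -> linear f -> linear (fun u => g (f u)) -> linear g.
Proof.
move=> [f' _ fK] lf lg k u v.
by rewrite -[u]fK -[v]fK -lf lg.
Qed.

Context {f : U -> V -> W} (bf : is_bilinear f).

Lemma bilinear_addl u u' v : f (u + u') v = f u v + f u' v.
Proof. exact: (linear_add (bf.1 v)). Qed.
Lemma bilinear_addr u v v' : f u (v + v') = f u v + f u v'.
Proof. exact: (linear_add (bf.2 u)). Qed.
Lemma bilinear_subl u u' v : f (u - u') v = f u v - f u' v.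
Proof. exact: (linear_sub (bf.1 v)). Qed.
Lemma bilinear_subr u v v' : f u (v - v') = f u v - f u v'.
Proof. exact: (linear_sub (bf.2 u)). Qed.
Lemma bilinear_scalel k u v : f (k *: u) v = k *: f u v.
Proof. exact: (linear_scale (bf.1 v)). Qed.
Lemma bilinear_scaler k u v : f u (k *: v) = k *: f u v.
Proof. exact: (linear_scale (bf.2 u)). Qed.

End Bilinearity.

(** * From BiHom-dendriform to BiHom-pre-Lie algebras *)

Record bihom_dendriform {K : fieldType} {A : lmodType K}
    (prec succ : A -> A -> A) (alpha beta : A -> A) : Prop := BiHomDendriform {
  bhd_prec_bilinear : is_bilinear prec;
  bhd_succ_bilinear : is_bilinear succ;
  bhd_alpha_linear : linear alpha;
  bhd_beta_linear : linear beta;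
  bhd_comm : forall a, alpha (beta a) = beta (alpha a);
  bhd_alpha_prec : forall a b, alpha (prec a b) = prec (alpha a) (alpha b);
  bhd_alpha_succ : forall a b, alpha (succ a b) = succ (alpha a) (alpha b);
  bhd_beta_prec : forall a b, beta (prec a b) = prec (beta a) (beta b);
  bhd_beta_succ : forall a b, beta (succ a b) = succ (beta a) (beta b);
  bhd_prec_prec : forall a b c,
    prec (prec a b) (beta c) = prec (alpha a) (prec b c + succ b c);
  bhd_succ_prec : forall a b c,
    prec (succ a b) (beta c) = succ (alpha a) (prec b c);
  bhd_succ_succ : forall a b c,
    succ (alpha a) (succ b c) = succ (prec a b + succ a b) (beta c)
}.

(** The shape of the pre-Lie associator once it is expanded: x1 + x2 and z1 + z2
    come from splitting total products, and x2 and z1 occur again in the second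
    composite.  Their cancellation leaves only the terms that pair up under the
    exchange of the first two variables. *)
Lemma associator_cancel (V : zmodType) (x1 x2 x3 y1 y2 z1 z2 z3 : V) :
  (x1 + x2 - y1) - (y2 - (z1 + z2)) - ((x2 - x3) - (z3 - z1))
  = (x1 + x3) - (y1 + y2) + (z2 + z3).
Proof.
rewrite !opprD !opprK !addrA.
rewrite [LHS](AC (10) (1*8*3*4*6*9*(2*7)*(5*10)))/=.
by rewrite !subrr !addr0.
Qed.

Section DendriformPreLie.
Context {K : fieldType} {A : lmodType K}.
Variables (prec succ op : A -> A -> A) (alpha beta : A -> A).
Hypothesis dend : bihom_dendriform prec succ alpha beta.
Hypothesis opE : forall a b,
  op (beta a) (alpha b) = succ (beta a) (alpha b) - prec (beta b) (alpha a).
Hypotheses (bij_alpha : bijective alpha) (bij_beta : bijective beta).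

Lemma dendriform_op_bilinear : is_bilinear op.
Proof.
case: dend => bp bs la lb _ _ _ _ _ _ _ _.
have [a' _ aK] := bij_alpha; have [b' _ bK] := bij_beta.
split=> v.
  apply: (linear_surj bij_beta lb) => k x y; rewrite -[v]aK !opE.
  exact: (linearP_sub _ _ (linearP_comp _ _ lb (bs.1 _))
                          (linearP_comp _ _ la (bp.2 _))).
apply: (linear_surj bij_alpha la) => k x y; rewrite -[v]bK !opE.
exact: (linearP_sub _ _ (linearP_comp _ _ la (bs.2 _))
                        (linearP_comp _ _ lb (bp.1 _))).
Qed.

(** Every variable of the pre-Lie identity is written as the image of another
    one, so that each product has the shape covered by [opE].  The dendriform
    axioms are used once each: [bhd_succ_succ] where c stands on the right,
    [bhd_succ_prec] where it stands in the middle, [bhd_prec_prec] where it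
    stands on the left.  The right-hand side is symmetric in a and b. *)
Lemma dendriform_associator a b c :
  op (alpha (beta (beta a))) (op (alpha (beta b)) (alpha (alpha c)))
    - op (op (beta (beta a)) (alpha (beta b))) (beta (alpha (alpha c)))
  = (succ (prec (beta (beta a)) (beta (alpha b))) (beta (alpha (alpha c)))
     + succ (prec (beta (beta b)) (beta (alpha a))) (beta (alpha (alpha c))))
    - (prec (succ (beta (beta a)) (beta (alpha c))) (beta (alpha (alpha b)))
       + prec (succ (beta (beta b)) (beta (alpha c))) (beta (alpha (alpha a))))
    + (prec (beta (beta (alpha c))) (succ (beta (alpha b)) (alpha (alpha a)))
       + prec (beta (beta (alpha c))) (succ (beta (alpha a)) (alpha (alpha b)))).
Proof.
case: dend => bp bs la lb ab ap as_ bp_ bs_ pp sp ss.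
have -> : op (alpha (beta b)) (alpha (alpha c))
  = alpha (succ (beta b) (alpha c) - prec (beta c) (alpha b)).
  by rewrite ab opE (linear_sub la) as_ ap !ab.
have -> : op (beta (beta a)) (alpha (beta b))
  = beta (succ (beta a) (alpha b) - prec (beta b) (alpha a)).
  by rewrite ab -ab opE (linear_sub lb) bs_ bp_ !ab.
rewrite [alpha (beta (beta a))]ab -[beta (alpha (alpha c))]ab !opE.
rewrite !(linear_sub la) !(linear_sub lb) !(as_, ap, bs_, bp_, ab).
rewrite !(bilinear_subl bs, bilinear_subr bs).
rewrite !(bilinear_subl bp, bilinear_subr bp).
have succ_expand x y z : succ (alpha x) (succ y z)
    = succ (prec x y) (beta z) + succ (succ x y) (beta z).
  by rewrite ss (bilinear_addl bs).
have prec_expand x y z : prec (prec x y) (beta z)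
    = prec (alpha x) (prec y z) + prec (alpha x) (succ y z).
  by rewrite pp (bilinear_addr bp).
have := succ_expand (beta (beta a)) (beta (alpha b)) (alpha (alpha c)).
have := sp (beta (beta a)) (beta (alpha c)) (alpha (alpha b)).
have := sp (beta (beta b)) (beta (alpha c)) (alpha (alpha a)).
have := prec_expand (beta (beta c)) (beta (alpha b)) (alpha (alpha a)).
rewrite !ab => -> -> <- ->.
exact: associator_cancel.
Qed.

Lemma dendriform_preLie : bihom_preLie op alpha beta.
Proof.
case: (dend) => bp bs la lb ab ap as_ bp_ bs_ _ _ _.
have [a' _ aK] := bij_alpha; have [b' _ bK] := bij_beta.
split=> //; first exact: dendriform_op_bilinear.
- by move=> a b; rewrite -[a]bK -[b]aK opE (linear_sub la) as_ ap !ab opE.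
- by move=> a b; rewrite -[a]bK -[b]aK opE (linear_sub lb) bs_ bp_ -!ab opE.
move=> a b c; rewrite -[a]bK -[b]bK -[c]aK -[a' c]aK !dendriform_associator.
by congr (_ - _ + _); rewrite addrC.
Qed.

End DendriformPreLie.

(** * From BiHom-modules to pre-Lie modules *)

(** By the module axiom (alpha beta a)(alpha b m) = ((beta a)(alpha b))(beta m),
    so the pre-Lie module axiom says that the actions of [op] and [mu] have the
    same skew part. *)
Lemma bihom_module_preLie {K : fieldType} {A M : lmodType K}
    (mu op : A -> A -> A) (alphaA betaA : A -> A)
    (act : A -> M -> M) (alphaM betaM : M -> M) :
  (forall a b, op (betaA a) (alphaA b) - op (betaA b) (alphaA a)
     = mu (betaA a) (alphaA b) - mu (betaA b) (alphaA a)) ->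
  bihom_module mu alphaA betaA act alphaM betaM ->
  preLie_module op alphaA betaA act alphaM betaM.
Proof.
move=> skew [ba la lb ab aact bact assoc]; split=> // a b m.
rewrite !assoc -!(bilinear_subl ba); congr (act _ _).
have /eqP := skew a b; rewrite subr_eq => /eqP ->.
by rewrite opprD opprB addrA [mu _ _ + _]addrC subrK.
Qed.

(** * The total product and its module *)

Section RotaBaxterModule.
Context {K : fieldType} {A M : lmodType K}.
Variables (lambda : K) (mu : A -> A -> A) (R alphaA betaA : A -> A).
Variables (act : A -> M -> M) (T alphaM betaM : M -> M).

Definition rb_total (a b : A) : A := mu (R a) b + mu a (R b) + lambda *: mu a b.

Hypothesis rbA : rota_baxter_bihom_associative lambda mu R alphaA betaA.
Hypothesis rbM :
  rota_baxter_paired_module lambda mu act R T alphaM betaM alphaA betaA.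

(** This is the Rota-Baxter identity, read as multiplicativity of R. *)
Lemma rb_total_morph a b : R (rb_total a b) = mu (R a) (R b).
Proof.
case: rbA => _ lR _ _ ->.
by rewrite /rb_total !(linear_add lR) (linear_scale lR).
Qed.

Lemma star_act_bilinear : is_bilinear (star_act lambda act R T).
Proof.
case: rbM => -[ba _ _ _ _ _ _] lR lT _ _ _ _ _; rewrite /star_act.
split=> [m | a]; apply: linearP_add.
- by apply: linearP_add; [apply: (linearP_comp _ _ lR (ba.1 m)) | apply: ba.1].
- by apply: linearP_scale; apply: ba.1.
- by apply: linearP_add; [apply: ba.2 | apply: (linearP_comp _ _ lT (ba.2 a))].
- by apply: linearP_scale; apply: ba.2.
Qed.

(** The three terms of T (star_act b m) form the right-hand side of the paired
    Rota-Baxter identity, so they collapse to R(b) T(m).  Both members then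
    expand to the same seven terms by the module axiom. *)
Lemma star_act_assoc a b m :
  star_act lambda act R T (alphaA a) (star_act lambda act R T b m)
  = star_act lambda act R T (rb_total a b) (betaM m).
Proof.
case: rbM => -[ba _ _ _ _ _ assoc] _ lT _ Tb Ra _ rb.
have TE : T (star_act lambda act R T b m) = act (R b) (T m).
  by rewrite rb /star_act !(linear_add lT) (linear_scale lT).
rewrite {1}/star_act TE {1 2}/star_act Ra [RHS]/star_act rb_total_morph Tb.
rewrite !(bilinear_addr ba) !(bilinear_scaler ba) !assoc /rb_total.
rewrite !(bilinear_addl ba) !(bilinear_scalel ba) !scalerDr !addrA.
by rewrite [LHS](AC 7 (1*2*4*6*3*5*7))/=.
Qed.

Lemma star_act_bihom_module :
  bihom_module rb_total alphaA betaA (star_act lambda act R T) alphaM betaM.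
Proof.
case: (rbM) => -[ba la lb ab aact bact _] _ lT Ta Tb Ra Rb _.
split=> //; first exact: star_act_bilinear.
- move=> a m; rewrite /star_act !(linear_add la) (linear_scale la) !aact.
  by rewrite Ra Ta.
- move=> a m; rewrite /star_act !(linear_add lb) (linear_scale lb) !bact.
  by rewrite Rb Tb.
exact: star_act_assoc.
Qed.

End RotaBaxterModule.

(** * The dendriform structure of a Rota-Baxter algebra *)

Section RotaBaxterDendriform.
Context {K : fieldType} {A : lmodType K}.
Variables (lambda : K) (mu : A -> A -> A) (R alphaA betaA : A -> A).
Hypothesis rbA : rota_baxter_bihom_associative lambda mu R alphaA betaA.

Definition rb_prec (a b : A) : A := mu a (R b).
Definition rb_succ (a b : A) : A := mu (R a) b + lambda *: mu a b.

(** T = 0 is always a paired operator; for the regular module its [star_act] is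
    [rb_succ], which therefore inherits the module properties. *)
Lemma regular_paired_module :
  rota_baxter_paired_module lambda mu mu R (fun=> 0) alphaA betaA alphaA betaA.
Proof.
case: rbA => -[bmu la lb ab am bm assoc] lR Ra Rb _.
split=> // [|a|a|a b]; first exact: linear_const0.
- by rewrite (linear_zero la).
- by rewrite (linear_zero lb).
- by rewrite (linear_zero (bmu.2 _)) scaler0 !addr0.
Qed.

Lemma rb_succE a b : rb_succ a b = star_act lambda mu R (fun=> 0) a b.
Proof.
have bmu := bha_mu_bilinear (rba_bha rbA).
by rewrite /star_act (linear_zero (bmu.2 a)) addr0.
Qed.

Lemma rb_totalE a b : rb_total lambda mu R a b = rb_prec a b + rb_succ a b.
Proof. by rewrite /rb_total /rb_succ addrA [mu _ _ + _]addrC. Qed.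

Lemma rb_dendriform : bihom_dendriform rb_prec rb_succ alphaA betaA.
Proof.
have [[sl sr] _ _ _ asucc bsucc succ_assoc] :=
  star_act_bihom_module _ _ _ _ _ _ _ _ _ rbA regular_paired_module.
case: (rbA) => -[bmu la lb ab am bm assoc] lR Ra Rb _.
split=> //.
- split=> [b | a]; first exact: bmu.1.
  exact: (linearP_comp _ _ lR (bmu.2 a)).
- by split=> [b | a] k x y; rewrite !rb_succE; [apply: sl | apply: sr].
- by move=> a b; rewrite /rb_prec am Ra.
- by move=> a b; rewrite !rb_succE.
- by move=> a b; rewrite /rb_prec bm Rb.
- by move=> a b; rewrite !rb_succE.
- move=> a b c; rewrite -rb_totalE /rb_prec (rb_total_morph _ _ _ _ _ rbA).
  by rewrite Rb assoc.
- move=> a b c; rewrite /rb_prec /rb_succ Rb Ra !assoc.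
  by rewrite (bilinear_addl bmu) (bilinear_scalel bmu).
by move=> a b c; rewrite -rb_totalE !rb_succE.
Qed.

Context (bij_alphaA : bijective alphaA) (bij_betaA : bijective betaA).

Lemma star_mulE a b :
  star_mul lambda mu R bij_alphaA bij_betaA (betaA a) (alphaA b)
  = rb_succ (betaA a) (alphaA b) - rb_prec (betaA b) (alphaA a).
Proof.
have ab := bha_comm (rba_bha rbA).
by rewrite /star_mul -ab !bij_invK.
Qed.

Lemma star_mul_skew a b :
  star_mul lambda mu R bij_alphaA bij_betaA (betaA a) (alphaA b)
    - star_mul lambda mu R bij_alphaA bij_betaA (betaA b) (alphaA a)
  = rb_total lambda mu R (betaA a) (alphaA b)
    - rb_total lambda mu R (betaA b) (alphaA a).
Proof.
rewrite !star_mulE !rb_totalE.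
(* Generalized, because associativity would unfold [rb_succ]. *)
move: (rb_succ _ _) (rb_succ _ _) (rb_prec _ _) (rb_prec _ _) => s1 s2 p1 p2.
rewrite opprB opprD !addrA.
by congr (_ - s1); rewrite addrAC [s2 + p1]addrC.
Qed.

End RotaBaxterDendriform.

Theorem theorem3p9 (K : fieldType) (lambda : K) (A M : lmodType K)
    (mu : A -> A -> A) (R alphaA betaA : A -> A)
    (act : A -> M -> M) (T alphaM betaM : M -> M)
    (bij_alphaA : bijective alphaA) (bij_betaA : bijective betaA) :
  rota_baxter_bihom_associative lambda mu R alphaA betaA ->
  rota_baxter_paired_module lambda mu act R T alphaM betaM alphaA betaA ->
  bihom_preLie (star_mul lambda mu R bij_alphaA bij_betaA) alphaA betaA /\
  preLie_module (star_mul lambda mu R bij_alphaA bij_betaA) alphaA betaA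
    (star_act lambda act R T) alphaM betaM.
Proof.
move=> rbA rbM; split.
  apply: (dendriform_preLie _ _ _ _ _ (rb_dendriform _ _ _ _ _ rbA)) => //.
  exact: star_mulE.
apply: bihom_module_preLie (star_act_bihom_module _ _ _ _ _ _ _ _ _ rbA rbM).
exact: star_mul_skew.
Qed.
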